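(* Any stringent skew hyperfield $R$ has the form $F\rtimes_{H,\psi}G$ (up to isomorphism), the $G$-layering of $F$ along a short exact sequence of groups $1\to F^\times\to H\xrightarrow{\psi}G\to1$ with stable sums, where $G$ is a totally ordered group and $F$ is either the Krasner hyperfield or the sign hyperfield or a skew field.
   Context: A hyperoperation on a set $S$ is a map $\boxplus$ from $S\times S$ to the nonempty subsets of $S$; for nonempty $A,B\subseteq S$ put $A\boxplus B=\bigcup_{a\in A,b\in B}a\boxplus b$; $\boxplus$ is associative if $a\boxplus(b\boxplus c)=(a\boxplus b)\boxplus c$ for all $a,b,c$. A hypergroup is $(G,\boxplus,0)$ with $\boxplus$ an associative hyperoperation such that: $0\boxplus x=x\boxplus 0=\{x\}$ for all $x$; for every $x$ there is a unique $x'$ with $0\in x\boxplus x'$ and a unique $x''$ with $0\in x''\boxplus x$, and $x'=x''$, denoted $-x$; and $x\in y\boxplus z$ if and only if $-x\in -z\boxplus -y$. It is commutative if $y\boxplus z=z\boxplus y$ for all $y,z$. A skew hyperring is $(R,\odot,\boxplus,1,0)$ with $(R,\odot,1)$ a monoid, $(R,\boxplus,0)$ a commutative hypergroup, $x\odot 0=0\odot x=0$, and $a\odot(x\boxplus y)=(a\odot x)\boxplus(a\odot y)$, $(x\boxplus y)\odot a=(x\odot a)\boxplus(y\odot a)$. A skew hyperfield is a skew hyperring with $0\ne1$ in which every nonzero element has a multiplicative inverse. It is stringent if $a\boxplus b$ is a singleton whenever $a\ne-b$. A skew field is regarded as a skew hyperfield with $a\boxplus b=\{a+b\}$. The Krasner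 hyperfield is $\mathbb{K}=\{0,1\}$ with usual multiplication, $0\boxplus x=x\boxplus 0=\{x\}$ and $1\boxplus1=\{0,1\}$. The sign hyperfield is $\mathbb{S}=\{0,1,-1\}$ with usual multiplication, $0\boxplus x=x\boxplus 0=\{x\}$, $x\boxplus x=\{x\}$, $1\boxplus-1=-1\boxplus 1=\{0,1,-1\}$. Layering: let $F$ be a skew hyperfield, $F^\times=F\setminus\{0_F\}$, $G$ a totally ordered group (order invariant under left and right multiplication), and $1\to F^{\times}\xrightarrow{\phi}H\xrightarrow{\psi}G\to1$ a short exact sequence of groups; replacing $H$ by an isomorphic copy, assume $\phi$ is the inclusion. For $h\in H$ put $x^h=h^{-1}xh$ for $x\in F^\times$ and $0_F^h=0_F$. The sequence has stable sums if for each $h\in H$ the map $x\mapsto x^h$ is an automorphism of the skew hyperfield $F$. In that case let $0$ be a new element not in $H$; for $g\in G$ let $A_g=\psi^{-1}(g)\cup\{0\}$ and, for any $h\in\psi^{-1}(g)$, let $\lambda_h:F\to A_g$ be the bijection $0_F\mapsto0$, $x\mapsto hx$. Transporting the hyperaddition of $F$ along $\lambda_h$ gives a hypergroup structure $\boxplus_g$ on $A_g$ independent of the choice of $h$. The $G$-layering $F\rtimes_{H,\psi}G$ has ground set $H\cup\{0\}$; multiplication is that of $H$, with $x\cdot y=0$ if $x$ or $y$ is $0$; $0$ is the additive identity and for $x,y\in H$: $x\boxplus y=\{x\}$ if $\psi(x)>\psi(y)$; $=\{y\}$ if $\psi(x)<\psi(y)$; $=x\boxplus_{\psi(x)}y$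 if $\psi(x)=\psi(y)$ and $0\notin x\boxplus_{\psi(x)}y$; $=(x\boxplus_{\psi(x)}y)\cup\{z\in H\mid\psi(z)<\psi(x)\}$ if $\psi(x)=\psi(y)$ and $0\in x\boxplus_{\psi(x)}y$. *)

(* Defs.v *)
From HB Require Import structures.
From mathcomp Require Import all_boot all_order ssralg.
From mathcomp Require Import boolp classical_sets.

Set Implicit Arguments.
Unset Strict Implicit.
Unset Printing Implicit Defensive.

Local Open Scope classical_set_scope.
Local Open Scope group_scope.

Definition hyperop (S : Type) := S -> S -> set S.

Definition hyperop_set S (add : hyperop S) (A B : set S) : set S :=
  \bigcup_(a in A) \bigcup_(b in B) add a b.

Definition hyperop_assoc S (add : hyperop S) :=
  forall a b c,
    hyperop_set add [set a] (add b c) = hyperop_set add (add a b) [set c].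

Definition hyperop_comm S (add : hyperop S) := forall a b, add a b = add b a.

(* [hg_oppr] and [hg_oppl] each say that [opp x] is the one and only right
   (resp. left) additive inverse of [x]; in particular [opp] is determined by
   [add] and [zero]. *)
Record is_hypergroup S (add : hyperop S) (zero : S) (opp : S -> S) : Prop :=
  IsHypergroup {
    hg_neq0 : forall x y, add x y !=set0;
    hg_assoc : hyperop_assoc add;
    hg_add0 : forall x, add zero x = [set x];
    hg_addr0 : forall x, add x zero = [set x];
    hg_oppr : forall x y, add x y zero <-> y = opp x;
    hg_oppl : forall x y, add y x zero <-> y = opp x;
    hg_rev : forall x y z, add y z x <-> add (opp z) (opp y) (opp x)
  }.

Record hyperstruct := Hyperstruct {
  hcarrier :> Type;
  hzero : hcarrier;
  hone : hcarrier;
  hmul : hcarrier -> hcarrier -> hcarrier;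
  hadd : hyperop hcarrier
}.

Arguments hzero {_}.
Arguments hone {_}.
Arguments hmul {_} _ _.
Arguments hadd {_} _ _ _.

Declare Scope hyper_scope.
Delimit Scope hyper_scope with H.
Notation "0" := hzero : hyper_scope.
Notation "1" := hone : hyper_scope.
Notation "x ⊙ y" := (hmul x y) (at level 40, left associativity) : hyper_scope.
Notation "x ⊞ y" := (hadd x y) (at level 50, left associativity) : hyper_scope.
Local Open Scope hyper_scope.

Record is_skew_hyperring (R : hyperstruct) (opp : R -> R) : Prop :=
  IsSkewHyperring {
    hr_mulA : forall x y z : R, x ⊙ (y ⊙ z) = (x ⊙ y) ⊙ z;
    hr_mul1 : forall x : R, 1 ⊙ x = x;
    hr_mulr1 : forall x : R, x ⊙ 1 = x;
    hr_hypergroup : is_hypergroup hadd 0 opp;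
    hr_addC : hyperop_comm (@hadd R);
    hr_mul0 : forall x : R, 0 ⊙ x = 0;
    hr_mulr0 : forall x : R, x ⊙ 0 = 0;
    hr_distl : forall a x y : R,
      [set a ⊙ z | z in x ⊞ y] = (a ⊙ x) ⊞ (a ⊙ y);
    hr_distr : forall a x y : R,
      [set z ⊙ a | z in x ⊞ y] = (x ⊙ a) ⊞ (y ⊙ a)
  }.

Record skewHyperfield := SkewHyperfield {
  hf_struct :> hyperstruct;
  hopp : hf_struct -> hf_struct;
  hf_hyperring : is_skew_hyperring hopp;
  hf_0neq1 : (0 : hf_struct) <> 1;
  hf_inv : forall x : hf_struct, x <> 0 -> exists y, x ⊙ y = 1 /\ y ⊙ x = 1
}.

Arguments hopp {_} _.

Definition stringent (R : skewHyperfield) :=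
  forall a b : R, a <> hopp b -> exists c : R, a ⊞ b = [set c].

Record is_hyper_iso (R S : hyperstruct) (f : R -> S) : Prop := IsHyperIso {
  hi_bij : bijective f;
  hi_0 : f 0 = 0;
  hi_1 : f 1 = 1;
  hi_mul : forall x y, f (x ⊙ y) = f x ⊙ f y;
  hi_add : forall x y, [set f z | z in x ⊞ y] = f x ⊞ f y
}.

Definition hyper_isomorphic (R S : hyperstruct) :=
  exists f : R -> S, is_hyper_iso f.

(* There is no library type of noncommutative skew fields: they are the
   [unitRingType]s in which every nonzero element is a unit. *)
Section SkewField.
Import GRing.Theory.
Variables (D : unitRingType)
  (unitD : forall x : D, x != 0%R -> x \is a GRing.unit).

Definition skewfield_struct : hyperstruct :=
  @Hyperstruct D 0%R 1%R *%R (fun a b => [set (a + b)%R]).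

Lemma skewfield_hyperring :
  @is_skew_hyperring skewfield_struct (fun x : D => (- x)%R).
Proof.
split=> /=.
- exact: mulrA.
- exact: mul1r.
- exact: mulr1.
- split=> /=.
  + by move=> x y; exists (x + y)%R.
  + by move=> a b c; rewrite /hyperop_set !bigcup_set1 addrA.
  + by move=> x; rewrite add0r.
  + by move=> x; rewrite addr0.
  + move=> x y; split=> [/esym/eqP|-> /=]; last by rewrite subrr.
    by rewrite addrC addr_eq0 => /eqP.
  + move=> x y; split=> [/esym/eqP|-> /=]; last by rewrite addNr.
    by rewrite addr_eq0 => /eqP.
  + move=> x y z; split=> /= [->|]; first by rewrite opprD addrC.
    by rewrite -opprD => /oppr_inj ->; rewrite addrC.
- by move=> a b /=; rewrite addrC.
- exact: mul0r.
- exact: mulr0.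
- by move=> a x y; rewrite image_set1 mulrDr.
- by move=> a x y; rewrite image_set1 mulrDl.
Qed.

Lemma skewfield_0neq1 : (0 : skewfield_struct) <> 1.
Proof. by apply/eqP; rewrite eq_sym oner_eq0. Qed.

Lemma skewfield_inv (x : skewfield_struct) :
  x <> 0 -> exists y, x ⊙ y = 1 /\ y ⊙ x = 1.
Proof.
move=> /eqP /unitD ux; exists (x : D)^-1%R.
by split; [exact: mulrV | exact: mulVr].
Qed.

Definition skewfield_hyperfield : skewHyperfield :=
  SkewHyperfield skewfield_hyperring skewfield_0neq1 skewfield_inv.
End SkewField.

Section FiniteTable.
Variables (T : Type) (e : seq T).
Hypothesis eP : forall P : pred T, (exists x, P x) <-> has P e.
Variables (add : hyperop T) (tbl : T -> T -> T -> bool).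
Hypothesis addE : forall x y z, add x y z <-> tbl x y z.

Lemma table_assoc :
  (forall a b c z, has (fun d => tbl b c d && tbl a d z) e =
                   has (fun d => tbl a b d && tbl d c z) e) ->
  hyperop_assoc add.
Proof.
move=> H a b c; apply/seteqP; split=> z.
- case=> _ -> [d /addE bcd /addE adz].
  have : has (fun d => tbl b c d && tbl a d z) e.
    by apply/eP; exists d; rewrite bcd adz.
  rewrite H => /eP[d' /andP[/addE abd' /addE d'cz]].
  by exists d' => //; exists c.
- case=> d /addE abd [_ -> /addE dcz].
  have : has (fun d => tbl a b d && tbl d c z) e.
    by apply/eP; exists d; rewrite abd dcz.
  rewrite -H => /eP[d' /andP[/addE bcd' /addE ad'z]].
  by exists a => //; exists d'.
Qed.
End FiniteTable.

Definition krasner_struct : hyperstruct :=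
  @Hyperstruct bool false true andb
    (fun x y => match x, y with
                | false, _ => [set y]
                | _, false => [set x]
                | true, true => [set false; true]
                end).

Definition krasner_table (x y z : bool) : bool :=
  match x, y with
  | false, _ => z == y
  | _, false => z == x
  | true, true => true
  end.

Lemma krasner_addE (x y z : krasner_struct) :
  (x ⊞ y) z <-> krasner_table x y z.
Proof. by case: x y z => [] [] []; split=> //= _; first [by left | by right]. Qed.

Lemma krasner_hyperring : @is_skew_hyperring krasner_struct id.
Proof.
split.
- exact: andbA.
- by case.
- by case.
- split.
  + by move=> x y; exists (x || y); apply/krasner_addE; case: x y => [] [].
  + apply: (@table_assoc _ [:: false; true] _ _ krasner_table krasner_addE).
      move=> P; split=> /= [[[] ->]|/or3P[]//]; rewrite ?orbT //.
        by exists false.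
      by exists true.
    by do 4 case.
  + by case.
  + by case.
  + by move=> x y; rewrite krasner_addE; case: x y => [] [].
  + by move=> x y; rewrite krasner_addE; case: x y => [] [].
  + by move=> x y z; rewrite !krasner_addE; case: x y z => [] [] [].
- by case=> [] [].
- by case.
- by case.
- case=> x y; first by rewrite image_id.
  apply/seteqP; split=> [_ [z _ <-] //|_ ->].
  by exists (x || y) => //; apply/krasner_addE; case: x y => [] [].
- case=> x y; rewrite [x ⊙ _]andbC [y ⊙ _]andbC.
  + have -> : (fun z : krasner_struct => z ⊙ true) = id.
      by apply/funext => z; exact: andbT.
    by rewrite image_id.
  + apply/seteqP; split=> [_ [z _ <-]|_ ->]; first exact: andbF.
    by exists (x || y); [apply/krasner_addE; case: x y => [] []|exact: andbF].
Qed.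

Lemma krasner_inv (x : krasner_struct) :
  x <> 0 -> exists y, x ⊙ y = 1 /\ y ⊙ x = 1.
Proof. by case: x => // _; exists true. Qed.

Lemma krasner_0neq1 : (0 : krasner_struct) <> 1. Proof. by []. Qed.

Definition krasner_hyperfield : skewHyperfield :=
  SkewHyperfield krasner_hyperring krasner_0neq1 krasner_inv.

Inductive sign := SZero | SPos | SNeg.

Definition sign_opp (x : sign) : sign :=
  match x with SZero => SZero | SPos => SNeg | SNeg => SPos end.

Definition sign_struct : hyperstruct :=
  @Hyperstruct sign SZero SPos
    (fun x y => match x with
                | SZero => SZero
                | SPos => y
                | SNeg => sign_opp y
                end)
    (fun x y => match x, y with
                | SZero, _ => [set y]
                | _, SZero => [set x]
                | SPos, SPos => [set SPos]
                | SNeg, SNeg => [set SNeg]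
                | SPos, SNeg | SNeg, SPos => [set SZero; SPos; SNeg]
                end).

Definition sign_table (x y z : sign) : bool :=
  match x, y, z with
  | SZero, SZero, SZero
  | SZero, SPos, SPos | SPos, SZero, SPos | SPos, SPos, SPos
  | SZero, SNeg, SNeg | SNeg, SZero, SNeg | SNeg, SNeg, SNeg
  | SPos, SNeg, _ | SNeg, SPos, _ => true
  | _, _, _ => false
  end.

Lemma sign_addE (x y z : sign_struct) : (x ⊞ y) z <-> sign_table x y z.
Proof.
by case: x y z => [||] [||] [||]; split=> //= _;
  first [by left; left | by left; right | by right].
Qed.

Lemma sign_mulC (x y : sign_struct) : x ⊙ y = y ⊙ x.
Proof. by case: x y => [||] [||]. Qed.

Lemma sign_hyperring : @is_skew_hyperring sign_struct sign_opp.
Proof.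
have distl (a x y : sign_struct) :
    [set a ⊙ z | z in x ⊞ y] = (a ⊙ x) ⊞ (a ⊙ y).
  apply/seteqP; split=> z.
    case=> w + <-; rewrite !sign_addE.
    by case: a x y w => [||] [||] [||] [||].
  rewrite sign_addE => h.
  pose w : sign_struct := match a with
    | SZero => if x is SZero then y else x
    | SPos => z
    | SNeg => sign_opp z
    end.
  by exists w; [apply/sign_addE|]; move: h; rewrite /w;
    case: a x y z {w} => [||] [||] [||] [||].
split.
- by do 3 case.
- by [].
- by case.
- split.
  + move=> x y; exists (if x is SZero then y else x : sign_struct).
    by apply/sign_addE; case: x y => [||] [||].
  + apply: (@table_assoc _ [:: SZero; SPos; SNeg] _ _ sign_table sign_addE).
      move=> P; split=> /= [[[||] ->]|/or4P[]//]; rewrite ?orbT //.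
      * by exists SZero.
      * by exists SPos.
      * by exists SNeg.
    by do 4 case.
  + by case.
  + by case.
  + by move=> x y; rewrite sign_addE; case: x y => [||] [||].
  + by move=> x y; rewrite sign_addE; case: x y => [||] [||].
  + by move=> x y z; rewrite !sign_addE; case: x y z => [||] [||] [||].
- by move=> x y; apply/seteqP; split=> z; rewrite !sign_addE;
    case: x y z => [||] [||] [||].
- by [].
- by case.
- exact: distl.
- move=> a x y; rewrite [x ⊙ _]sign_mulC [y ⊙ _]sign_mulC -distl.
  by apply: eq_imagel => z _; exact: sign_mulC.
Qed.

Lemma sign_0neq1 : (0 : sign_struct) <> 1. Proof. by []. Qed.

Lemma sign_inv (x : sign_struct) :
  x <> 0 -> exists y, x ⊙ y = 1 /\ y ⊙ x = 1.
Proof. by case: x => // _; [exists SPos|exists SNeg]. Qed.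

Definition sign_hyperfield : skewHyperfield :=
  SkewHyperfield sign_hyperring sign_0neq1 sign_inv.

Definition units (F : skewHyperfield) : Type := {x : F | x <> 0}.

Definition mk_unit (F : skewHyperfield) (x : F) (x0 : x <> 0) : units F :=
  exist _ x x0.

Lemma mk_unitE (F : skewHyperfield) (y : units F) (y0 : sval y <> 0) :
  mk_unit y0 = y.
Proof. by case: y y0 => y y1 y0; exact: eq_exist. Qed.

Section Units.
Variable F : skewHyperfield.
Implicit Types x y z : units F.

Let FP := @hf_hyperring F.

HB.instance Definition _ := gen_eqMixin (units F).
HB.instance Definition _ := gen_choiceMixin (units F).

Lemma units_mul_subproof x y : sval x ⊙ sval y <> 0.
Proof.
case: x y => [x x0] [y y0] /= xy0; apply: y0.
have [x' [_ x'x]] := hf_inv x0.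
by rewrite -(hr_mul1 FP y) -x'x -(hr_mulA FP) xy0 (hr_mulr0 FP).
Qed.

Definition units_one : units F := mk_unit (fun e => @hf_0neq1 F (esym e)).

Definition units_mul x y : units F := mk_unit (@units_mul_subproof x y).

Lemma units_inv_subproof x : exists y : units F,
  sval x ⊙ sval y = 1 /\ sval y ⊙ sval x = 1.
Proof.
have [y [xy yx]] := hf_inv (svalP x).
suff y0 : y <> 0 by exists (mk_unit y0).
by move=> y0; apply: (@hf_0neq1 F); rewrite -xy y0 (hr_mulr0 FP).
Qed.

Definition units_inv x : units F := sval (cid (units_inv_subproof x)).

Lemma units_mulA : associative units_mul.
Proof. by move=> x y z; apply: eq_exist; exact: (hr_mulA FP). Qed.

Lemma units_mul1 : left_id units_one units_mul.
Proof. by case=> x x0; apply: eq_exist; exact: (hr_mul1 FP). Qed.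

Lemma units_mulr1 : right_id units_one units_mul.
Proof. by case=> x x0; apply: eq_exist; exact: (hr_mulr1 FP). Qed.

Lemma units_mulV : left_inverse units_one units_inv units_mul.
Proof.
by move=> x; apply: eq_exist; case: (svalP (cid (units_inv_subproof x))).
Qed.

Lemma units_mulrV : right_inverse units_one units_inv units_mul.
Proof.
by move=> x; apply: eq_exist; case: (svalP (cid (units_inv_subproof x))).
Qed.

HB.instance Definition _ := isGroup.Build (units F)
  units_mulA units_mul1 units_mulr1 units_mulV units_mulrV.
End Units.

HB.mixin Record isOrderedGroup (d : Order.disp_t) G
    of Group G & Order.Total d G := {
  le_mulg2l : forall x y z : G, (y <= z)%O -> (x * y <= x * z)%O;
  le_mulg2r : forall x y z : G, (y <= z)%O -> (y * x <= z * x)%O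
}.

#[short(type="orderedGroupType")]
HB.structure Definition OrderedGroup (d : Order.disp_t) :=
  {G of isOrderedGroup d G & Group G & Order.Total d G}.

Notation "{ 'grouphom' K -> H }" := (UMagmaMorphism.type K%type H%type)
  (at level 0, K at level 98, H at level 99,
   format "{ 'grouphom'  K  ->  H }") : type_scope.

Definition short_exact (K H G : groupType)
    (phi : {grouphom K -> H}) (psi : {grouphom H -> G}) :=
  [/\ injective phi, range phi = psi @^-1` [set 1%g] & range psi = [set: G]].

Section Layering.
Variables (F : skewHyperfield) (d : Order.disp_t) (G : orderedGroupType d).
Variables (H : groupType).
Variables (phi : {grouphom units F -> H}) (psi : {grouphom H -> G}).

(* [x^h], where [phi] need not be an inclusion: for [x <> 0] it is the element
   of [units F] sent by [phi] to [h^-1 * phi x * h]. The default value [1] of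
   [xget] is never used when the sequence is exact, see [conjhE]. *)
Definition conjh (h : H) (x : F) : F :=
  match pselect (x = 0) with
  | left _ => 0
  | right x0 =>
      sval (xget (1%g : units F) [set y | phi y = phi (mk_unit x0) ^ h])
  end.

Definition stable_sums := forall h : H, is_hyper_iso (conjh h).

(* The ground set is [option H], with [None] as the new element [0]. *)
Definition lay_mul (x y : option H) : option H :=
  match x, y with
  | Some a, Some b => Some (a * b)%g
  | _, _ => None
  end.

Definition phi0 (x : F) : option H :=
  match pselect (x = 0) with
  | left _ => None
  | right x0 => Some (phi (mk_unit x0))
  end.

Definition lambda (h : H) (x : F) : option H := lay_mul (Some h) (phi0 x).

Definition transport_add (h : H) (x y : option H) : set (option H) :=
  [set z | exists a b c : F,
    [/\ x = lambda h a, y = lambda h b, z = lambda h c & (a ⊞ b) c]].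

(* [x ⊞_g y]; by [layer_addE] below any single [h] over [g] gives the same
   set. *)
Definition layer_add (g : G) (x y : option H) : set (option H) :=
  \bigcup_(h in psi @^-1` [set g]) transport_add h x y.

Definition lay_add (x y : option H) : set (option H) :=
  match x, y with
  | None, _ => [set y]
  | _, None => [set x]
  | Some a, Some b =>
      if (psi b < psi a)%O then [set x]
      else if (psi a < psi b)%O then [set y]
      else if `[< layer_add (psi a) x y None >] then
        layer_add (psi a) x y `|` [set Some c | c in [set c | (psi c < psi a)%O]]
      else layer_add (psi a) x y
  end.

Definition layering : hyperstruct := Hyperstruct None (Some 1%g) lay_mul lay_add.

Hypothesis exact : short_exact phi psi.

Lemma conjh0 (h : H) : conjh h 0 = 0.
Proof. by rewrite /conjh; case: pselect. Qed.

Lemma conjhE (h : H) (x : F) (x0 : x <> 0) :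
  exists y0 : conjh h x <> 0, phi (mk_unit y0) = phi (mk_unit x0) ^ h.
Proof.
have [_ imphi _] := exact.
rewrite /conjh; case: pselect => // x0'.
rewrite (_ : x0' = x0); last exact: Prop_irrelevance.
have : (psi @^-1` [set 1%g]) (phi (mk_unit x0) ^ h).
  have /= phiK : (psi @^-1` [set 1%g]) (phi (mk_unit x0)).
    by rewrite -imphi; exists (mk_unit x0).
  by rewrite /= gmulfJ phiK conj1g.
rewrite -imphi => -[u _ eu].
case: xgetP => [y _ /= yP|/(_ u)]; last by rewrite /= eu.
by exists (svalP y); rewrite -yP mk_unitE.
Qed.

Lemma lambda0 (h : H) : lambda h 0 = None.
Proof. by rewrite /lambda /phi0; case: pselect. Qed.

Lemma lambdaE (h : H) (x : units F) : lambda h (sval x) = Some (h * phi x)%g.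
Proof.
rewrite /lambda /phi0; case: pselect => [|x0]; first by case: x.
by rewrite /= mk_unitE.
Qed.

Lemma lambdaM (h : H) (k : units F) (x : F) :
  lambda (h * phi k) x = lambda h (sval k ⊙ x).
Proof.
case: (pselect (x = 0)) => [->|x0].
  by rewrite (hr_mulr0 (hf_hyperring F)) !lambda0.
rewrite -[x]/(sval (mk_unit x0)) lambdaE.
by rewrite -[_ ⊙ _]/(sval (k * mk_unit x0)%g) lambdaE gmulfM mulgA.
Qed.

Lemma transport_addS (h : H) (k : units F) (x y : option H) :
  transport_add (h * phi k) x y `<=` transport_add h x y.
Proof.
move=> z [a [b [c [-> -> -> abc]]]]; exists (sval k ⊙ a), (sval k ⊙ b).
exists (sval k ⊙ c); split; rewrite ?lambdaM //.
by rewrite -(hr_distl (hf_hyperring F)); exists c.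
Qed.

Lemma layer_addE (h : H) (x y : option H) :
  layer_add (psi h) x y = transport_add h x y.
Proof.
have [_ imphi _] := exact.
apply/seteqP; split=> [z [h' /= hh']|z xyz]; last by exists h.
have : (psi @^-1` [set 1%g]) (h^-1 * h')%g.
  by rewrite /= gmulfM gmulfV hh' mulVg.
rewrite -imphi => -[k _ kE].
by rewrite -[h'](mulVKg h) -kE => /transport_addS.
Qed.
End Layering.

(* Main.v *)
(* Say that [z] lies below [x <> 0] when [x + z = {x} = x - z]. In a stringent
   skew hyperfield this relation is a strict weak order (the point is its
   negative transitivity) invariant under multiplication, so its
   incomparability classes of units form a totally ordered quotient group [G]
   of [H], the group of units. The sum of two elements of a class stays in the
   class, except that [x - x] consists of [0], everything below [x], and
   possibly elements of the class of [x]. If [1 - 1] contains an element of the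
   class of [1], then this class is [{1, -1}] and the layer is the Krasner or
   the sign hyperfield; otherwise sums within the layer are single-valued and
   it is a skew field. *)
Require Import Defs.
From HB Require Import structures.
From mathcomp Require Import all_boot all_order ssralg.
From mathcomp Require Import boolp classical_sets.

Set Implicit Arguments.
Unset Strict Implicit.
Unset Printing Implicit Defensive.

(** * Sums, negatives and products in a skew hyperfield *)

Section HyperfieldTheory.
Local Open Scope classical_set_scope.
Local Open Scope hyper_scope.
Local Notation "- x" := (hopp x) : hyper_scope.
Variable R : skewHyperfield.
Implicit Types a b c s t u v x y z : R.

Let RP := @hf_hyperring R.
Let GP := hr_hypergroup RP.

Lemma hadd0 x : 0 ⊞ x = [set x]. Proof. exact: (hg_add0 GP). Qed.

Lemma haddx0 x : x ⊞ 0 = [set x]. Proof. exact: (hg_addr0 GP). Qed.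

Lemma haddC x y : x ⊞ y = y ⊞ x. Proof. exact: (hr_addC RP). Qed.

Lemma hadd_neq0 x y : x ⊞ y !=set0. Proof. exact: (hg_neq0 GP). Qed.

Lemma haddN_eq x y : (x ⊞ y) 0 <-> y = - x. Proof. exact: (hg_oppr GP). Qed.

Lemma haddxN x : (x ⊞ - x) 0. Proof. exact/haddN_eq. Qed.

Lemma hoppK x : - - x = x.
Proof. by apply/esym/haddN_eq; rewrite haddC; exact: haddxN. Qed.

Lemma hopp_inj x y : - x = - y -> x = y.
Proof. by move=> /(congr1 hopp); rewrite !hoppK. Qed.

Lemma hopp0 : - 0 = 0 :> R.
Proof. by apply/esym/haddN_eq; rewrite hadd0. Qed.

Lemma hopp_eq0 x : - x = 0 -> x = 0.
Proof. by rewrite -[in RHS]hopp0 => /hopp_inj. Qed.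

Lemma haddA_set a b c d e : b ⊞ c = [set d] -> a ⊞ b = [set e] ->
  a ⊞ d = e ⊞ c.
Proof.
move=> bc ab; have := hg_assoc GP a b c.
by rewrite /hyperop_set bc ab !bigcup_set1.
Qed.

Lemma haddA_ex a b c d z : (b ⊞ c) d -> (a ⊞ d) z ->
  exists2 e, (a ⊞ b) e & (e ⊞ c) z.
Proof.
move=> bcd adz; have : hyperop_set hadd [set a] (b ⊞ c) z.
  by exists a => //; exists d.
by rewrite (hg_assoc GP) => -[e abe [_ -> ez]]; exists e.
Qed.

(** As [0] lies in [- z ⊞ (x ⊞ y)], associativity yields some [e] in [- z ⊞ x] with [y = - e];
    negating the membership of [e] gives the claim. *)
Lemma hadd_rev x y z : (x ⊞ y) z -> (z ⊞ - x) y.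
Proof.
move=> xyz; have z0 : (- z ⊞ z) 0 by rewrite haddC; exact: haddxN.
have [e zxe /haddN_eq ye] := haddA_ex xyz z0.
by apply/(hg_rev GP); rewrite hoppK haddC ye hoppK.
Qed.

Lemma haddN x y z : (x ⊞ y) z -> (- x ⊞ - y) (- z).
Proof. by move=> /(hg_rev GP); rewrite haddC. Qed.

Lemma haddNE x y : - x ⊞ - y = hopp @` (x ⊞ y).
Proof.
apply/seteqP; split=> [z /haddN|_ [z xyz <-]]; last exact: haddN.
by rewrite !hoppK => xyz; exists (- z); rewrite ?hoppK.
Qed.

Lemma haddN_set1 x y z : x ⊞ y = [set z] -> - x ⊞ - y = [set - z].
Proof. by rewrite haddNE => ->; rewrite image_set1. Qed.

(** Distributivity puts [x ⊙ 0 = 0] into [x ⊙ y ⊞ x ⊙ - y], and additive inverses are unique. *)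
Lemma hmulN x y : x ⊙ - y = - (x ⊙ y).
Proof.
apply/haddN_eq; rewrite -(hr_distl RP); exists 0; first exact: haddxN.
exact: (hr_mulr0 RP).
Qed.

Lemma hmulNl x y : - x ⊙ y = - (x ⊙ y).
Proof.
apply/haddN_eq; rewrite -(hr_distr RP); exists 0; first exact: haddxN.
exact: (hr_mul0 RP).
Qed.

Lemma hmul_neq0 x y : x <> 0 -> y <> 0 -> x ⊙ y <> 0.
Proof.
by move=> x0 y0; exact: (@units_mul_subproof _ (mk_unit x0) (mk_unit y0)).
Qed.

(** * The relation [below] and its incomparability classes *)

(** Asking for both signs makes the relation invariant under negation of either argument; [x <> 0]
    keeps it irreflexive at [0]. *)
Definition below z x := [/\ x <> 0, x ⊞ z = [set x] & x ⊞ - z = [set x]].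

Definition layer x y := ~ below x y /\ ~ below y x.

Lemma below0 x : x <> 0 -> below 0 x.
Proof. by move=> x0; split; rewrite ?hopp0 ?haddx0. Qed.

Lemma below_irr x : ~ below x x.
Proof.
move=> [x0 _ xNx]; apply/x0/esym.
by have := haddxN x; rewrite xNx.
Qed.

(** By associativity, [x + z = (x + y) + z = x + (y + z) = x + y = x], and likewise with [- z]. *)
Lemma below_trans x y z : below z y -> below y x -> below z x.
Proof.
move=> [y0 yz yNz] [x0 xy xNy]; split=> //.
  by rewrite -(haddA_set yz xy).
by rewrite -(haddA_set yNz xy).
Qed.

Lemma below_asym x y : below x y -> ~ below y x.
Proof. by move=> xy yx; exact: (below_irr (below_trans xy yx)). Qed.

Lemma belowN z x : below z x -> below (- z) x.
Proof. by move=> [x0 xz xNz]; split; rewrite ?hoppK. Qed.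

Lemma belowNr z x : below z x -> below z (- x).
Proof.
move=> [x0 /haddN_set1 xz /haddN_set1 xNz]; split; first by move/hopp_eq0.
  by rewrite hoppK in xNz.
by [].
Qed.

Lemma below_neq0 x y : below x y -> y <> 0. Proof. by case. Qed.

Lemma below_add x y z : below x y -> (x ⊞ y) z -> z = y.
Proof. by case=> _ yx _; rewrite haddC yx. Qed.

Lemma below_mul2l a x y : a <> 0 -> below x y -> below (a ⊙ x) (a ⊙ y).
Proof.
move=> a0 [y0 yx yNx]; split; first exact: hmul_neq0.
  by rewrite -(hr_distl RP) yx image_set1.
by rewrite -hmulN -(hr_distl RP) yNx image_set1.
Qed.

Lemma below_mul2r a x y : a <> 0 -> below x y -> below (x ⊙ a) (y ⊙ a).
Proof.
move=> a0 [y0 yx yNx]; split; first exact: hmul_neq0.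
  by rewrite -(hr_distr RP) yx image_set1.
by rewrite -hmulNl -(hr_distr RP) yNx image_set1.
Qed.

Lemma below_mul2lE a x y : a <> 0 -> below (a ⊙ x) (a ⊙ y) <-> below x y.
Proof.
move=> a0; split=> [|/below_mul2l]; last exact.
have [b [ab ba]] := hf_inv a0.
have b0 : b <> 0.
  by move=> b0; apply: (@hf_0neq1 R); rewrite -ab b0 (hr_mulr0 RP).
by move/(below_mul2l b0); rewrite !(hr_mulA RP) ba !(hr_mul1 RP).
Qed.

Lemma below_mul2rE a x y : a <> 0 -> below (x ⊙ a) (y ⊙ a) <-> below x y.
Proof.
move=> a0; split=> [|/below_mul2r]; last exact.
have [b [ab ba]] := hf_inv a0.
have b0 : b <> 0.
  by move=> b0; apply: (@hf_0neq1 R); rewrite -ab b0 (hr_mulr0 RP).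
by move/(below_mul2r b0); rewrite -!(hr_mulA RP) ab !(hr_mulr1 RP).
Qed.

Lemma layer_mul2l a x y : a <> 0 -> layer (a ⊙ x) (a ⊙ y) <-> layer x y.
Proof. by move=> a0; rewrite /layer !below_mul2lE. Qed.

Lemma layer_mul2r a x y : a <> 0 -> layer (x ⊙ a) (y ⊙ a) <-> layer x y.
Proof. by move=> a0; rewrite /layer !below_mul2rE. Qed.

Lemma hmulI a : a <> 0 -> injective (hmul a).
Proof.
move=> a0 x y /(congr1 (hmul (sval (mk_unit a0)^-1%g : R))).
have := congr1 sval (mulVg (mk_unit a0)) => /= aVa.
by rewrite !(hr_mulA RP) aVa !(hr_mul1 RP).
Qed.

Lemma hmulIr a : a <> 0 -> injective (hmul^~ a).
Proof.
move=> a0 x y /(congr1 (hmul^~ (sval (mk_unit a0)^-1%g : R))).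
have := congr1 sval (mulgV (mk_unit a0)) => /= aaV.
by rewrite -!(hr_mulA RP) aaV !(hr_mulr1 RP).
Qed.

Lemma hadd_mul2l a x y z : a <> 0 ->
  (a ⊙ x ⊞ a ⊙ y) (a ⊙ z) <-> (x ⊞ y) z.
Proof.
move=> a0; rewrite -(hr_distl RP); split=> [[w xyw /(hmulI a0) <-] //|xyz].
by exists z.
Qed.

Lemma hadd_mul2r a x y z : a <> 0 ->
  (x ⊙ a ⊞ y ⊙ a) (z ⊙ a) <-> (x ⊞ y) z.
Proof.
move=> a0; rewrite -(hr_distr RP); split=> [[w xyw /(hmulIr a0) <-] //|xyz].
by exists z.
Qed.

Lemma layerxx x : layer x x.
Proof. by split; exact: below_irr. Qed.

Lemma layerC x y : layer x y -> layer y x.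
Proof. by case. Qed.

Lemma layerN x : layer x (- x).
Proof.
split; first by move/belowNr; rewrite hoppK; exact: below_irr.
by move/belowN; rewrite hoppK; exact: below_irr.
Qed.

Lemma layer_neq0 x y : layer x y -> y <> 0 -> x <> 0.
Proof. by case=> nxy _ y0 x0; apply: nxy; rewrite x0; exact: below0. Qed.

(** * Stringency: negative transitivity and sums within a layer *)

Hypothesis stringentR : stringent R.

(** Since [x] absorbs [z], adding [± z] to [± y] does not change the sum with [x]. Either this
    already leaves [± y] unchanged, so that [y] absorbs [z], or two different elements have the same
    sum with [x], which forces [x] to absorb [y]. *)
Lemma below_cotrans x y z : below z x -> below z y \/ below y x.
Proof.
move=> zx; have [x0 xz xNz] := zx.
(* Once [y] differs from [0], [± x] and [± z], all sums of [± y] with [x] and with [z] are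
   single-valued. *)
have [->|y0] := pselect (y = 0); first by right; exact: below0.
have [->|yx] := pselect (y = x); first by left.
have [->|yNx] := pselect (y = - x); first by left; exact: belowNr.
have [->|yz] := pselect (y = z); first by right.
have [->|yNz] := pselect (y = - z); first by right; exact: belowN.
have [s xys] : exists s, x ⊞ y = [set s].
  by apply: stringentR => e; apply: yNx; rewrite e hoppK.
have [t xNyt] : exists t, x ⊞ - y = [set t].
  by apply: stringentR; rewrite hoppK => /esym.
have [w zyw] : exists w, z ⊞ y = [set w].
  by apply: stringentR => e; apply: yNz; rewrite e hoppK.
have [v zNyv] : exists v, z ⊞ - y = [set v].
  by apply: stringentR; rewrite hoppK => /esym.
(* [x + p = x + w' = s'] puts both [p] and [w'] in [s' - x]. *)
have key p w' s' : p <> w' -> x ⊞ p = [set s'] -> x ⊞ w' = [set s'] -> s' = x.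
  move=> pw xp xw; apply: contrapT => sx.
  have [|u xu] := @stringentR s' (- x); first by rewrite hoppK.
  have: (s' ⊞ - x) p by apply: hadd_rev; rewrite xp.
  have: (s' ⊞ - x) w' by apply: hadd_rev; rewrite xw.
  by rewrite xu => /= wu pu; apply: pw; rewrite wu.
(* Reassociate [x + (± z ± y)] and let [x] absorb [± z]. *)
have xw : x ⊞ w = [set s] by rewrite (haddA_set zyw xz).
have xv : x ⊞ v = [set t] by rewrite (haddA_set zNyv xz).
have xNw : x ⊞ - w = [set t] by rewrite (haddA_set (haddN_set1 zyw) xNz).
have xNv : x ⊞ - v = [set s].
  by have := haddN_set1 zNyv; rewrite hoppK => e; rewrite (haddA_set e xNz).
(* If [y <> w] or [- y <> v], then [key] applies for both signs and [y] is below [x]; otherwise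
   [z + y = y] and [z - y = - y], so [z] is below [y]. *)
have [yw|yw] := pselect (y = w); last first.
  right; split=> //; first by rewrite xys (key _ _ _ yw xys xw).
  by rewrite xNyt (key (- y) (- w) t) // => /hopp_inj.
have [yv|yv] := pselect (- y = v); last first.
  right; split=> //; last by rewrite xNyt (key _ _ _ yv xNyt xv).
  by rewrite xys (key y (- v) s) // => e; apply: yv; rewrite e hoppK.
left; split=> //; first by rewrite haddC zyw yw.
by have := haddN_set1 zNyv; rewrite hoppK -yv hoppK haddC.
Qed.

(** Transitivity of incomparability is negative transitivity of [below], contraposed. *)
Lemma layer_trans x y z : layer x y -> layer y z -> layer x z.
Proof.
move=> [xy yx] [yz zy]; split; first by move/(@below_cotrans _ y) => [].
by move/(@below_cotrans _ y) => [].
Qed.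

Lemma below_layerl x x' y : layer x x' -> below x y -> below x' y.
Proof. by move=> [xx' x'x] /(@below_cotrans _ x')[]. Qed.

Lemma below_layerr x y y' : layer y y' -> below x y -> below x y'.
Proof. by move=> [yy' y'y] /(@below_cotrans _ y')[]. Qed.

Lemma layer_mul x x' y y' : layer x x' -> layer y y' ->
  layer (x ⊙ y) (x' ⊙ y').
Proof.
move=> xx' yy'; have [x0|x0] := pselect (x = 0).
  have -> : x' = 0 by apply: contrapT => /(layer_neq0 xx').
  by rewrite x0 !(hr_mul0 RP); exact: layerxx.
have [y0|y0] := pselect (y' = 0).
  have -> : y = 0 by apply: contrapT => /(layer_neq0 (layerC yy')).
  by rewrite y0 !(hr_mulr0 RP); exact: layerxx.
by apply: (@layer_trans _ (x ⊙ y')); [rewrite layer_mul2l|rewrite layer_mul2r].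
Qed.

Lemma haddN_below x z : below z x -> (x ⊞ - x) z.
Proof. by move=> [_ xz _]; apply: hadd_rev; rewrite xz. Qed.

(** By reversal [y] lies in [z ⊞ - x]. If [x] were below [z], this would force [y = z], against
    [layer x y]. If [z] is below [x], hence below [- x], it forces [y = - x]. *)
Lemma hadd_layer x y z : layer x y -> (x ⊞ y) z ->
  layer x z \/ y = - x /\ (z = 0 \/ below z x).
Proof.
move=> xy xyz; have zx : (z ⊞ - x) y by exact: hadd_rev.
have nxz : ~ below x z.
  move=> /belowN xz; case: xy => nxy _; apply: nxy.
  have -> := below_add xz (z := y); first by rewrite -[x]hoppK; exact: belowN.
  by rewrite haddC.
have [zltx|nzx] := pselect (below z x); last by left.
right; split; last by right.
exact: (below_add (belowNr zltx) zx).
Qed.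

Lemma layer_mul1l x y : x <> 0 -> layer x (x ⊙ y) <-> layer 1 y.
Proof. by move=> x0; rewrite -{1}[x](hr_mulr1 RP) layer_mul2l. Qed.

(** * The layer of [1] when [1 - 1] meets it *)

Lemma hone_neq0 : (1 : R) <> 0. Proof. exact/nesym/hf_0neq1. Qed.

(** Reversal puts [1] into both [1 + u] and [1 - u]. Unless [u] is [1] or [- 1], these sums are
    single-valued, hence equal to [{1}], and [u] would be below [1]. *)
Lemma layer1_idem u : layer 1 u -> (1 ⊞ hopp (1 : R)) u -> (1 ⊞ 1) (1 : R).
Proof.
move=> [n1u nu1] u11.
have uN1 : (u ⊞ 1) 1.
  by have := u11; rewrite haddC => /hadd_rev; rewrite hoppK.
have Nu1 : (- u ⊞ 1) 1.
  by have := haddN (hadd_rev u11); rewrite !hoppK.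
have [e|u1] := pselect (1 = u); first by rewrite -e in uN1.
have [e|u1'] := pselect (1 = - u); first by rewrite -e in Nu1.
case: nu1; split; first exact: hone_neq0.
  have [|c cE] := @stringentR 1 u; first by [].
  by move: uN1; rewrite haddC cE => ->.
have [|c cE] := @stringentR 1 (- u); first by rewrite hoppK.
by move: Nu1; rewrite haddC cE => ->.
Qed.

Lemma idem_haddN v : (1 ⊞ 1) (1 : R) -> (v ⊞ - v) v /\ (v ⊞ - v) (- v).
Proof.
move=> i; have i1 : (1 ⊞ hopp (1 : R)) 1 by exact: hadd_rev.
have v1 : (v ⊞ - v) v.
  rewrite -[v](hr_mulr1 RP) -hmulN -(hr_distl RP); exists 1 => //.
by split=> //; have := haddN v1; rewrite hoppK haddC.
Qed.

(** For any other [v] the sums [1 + v = {s}] and [1 - v = {t}] are single-valued. Every case then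
    makes [v] below [1] or [1] below [s], although [v] and [s] both lie in the layer of [1]. *)
Lemma idem_layer1 v :
  (1 ⊞ 1) (1 : R) -> layer 1 v -> v = 1 \/ v = hopp (1 : R).
Proof.
move=> i l1v; have [nltv nlt1] := l1v.
apply: contrapT => /not_orP[v1 vN1].
have [vv vNv] := idem_haddN v i.
have [s sE] : exists s, 1 ⊞ v = [set s].
  by apply: stringentR => e; apply: vN1; rewrite e hoppK.
have [t tE] : exists t, 1 ⊞ - v = [set t].
  by apply: stringentR; rewrite hoppK => /esym.
have [nlt1s _] : layer 1 s.
  by have [||//|[/vN1]] := @hadd_layer 1 v s; rewrite ?sE.
(* If [1 = - 1], absorbing one sign means absorbing both: either [s = 1] and [v] is below [1], or
   [s + 1] is single-valued and contains [s], so [1] is below [s]. *)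
have [one|one] := pselect (1 = hopp (1 : R)).
  have [s1|s1] := pselect (s = hopp (1 : R)).
    apply: nlt1; split; [exact: hone_neq0|by rewrite sE s1 -one|].
    by have := haddN_set1 sE; rewrite s1 hoppK -one.
  have [w wE] := stringentR s1.
  have ss : (s ⊞ 1) s.
    have sv : (v ⊞ 1) s by rewrite haddC sE.
    by have [e] := haddA_ex i sv; rewrite haddC sE => ->.
  apply: nlt1s; split; rewrite -?one.
  - move=> s0; move: sE; rewrite s0 => sE; apply: vN1; apply/haddN_eq.
    by rewrite sE.
  - by move: ss; rewrite wE => ->.
  - by move: ss; rewrite wE => ->.
have i1 : 1 ⊞ 1 = [set (1 : R)].
  by have [w wE] := stringentR one; move: i; rewrite wE => ->.
have ss : 1 ⊞ s = [set s] by rewrite (haddA_set sE i1).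
have tt : 1 ⊞ t = [set t] by rewrite (haddA_set tE i1).
have st : s ⊞ t = s ⊞ - v.
  by apply: haddA_set tE _; rewrite haddC.
(* [s + t = s - v] contains [1], [s] and [t]. *)
have st1 : (s ⊞ t) 1.
  by rewrite st; apply: hadd_rev; rewrite haddC sE.
have sts : (s ⊞ t) s.
  have sv : (1 ⊞ v) s by rewrite sE.
  by rewrite st; have [e] := haddA_ex vv sv; rewrite sE => ->.
have stt : (s ⊞ t) t.
  have sv : (1 ⊞ - v) t by rewrite tE.
  by rewrite st; have [e] := haddA_ex vNv sv; rewrite sE => ->.
(* If [s <> - t], the sum is single-valued, so [s = t = 1] and [v] is below [1]. If [s = - t],
   negating [1 + t = {t}] shows that [s] absorbs [- 1] as well as [1]. *)
have [sNt|sNt] := pselect (s = - t); last first.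
  have [w wE] := stringentR sNt.
  move: st1 sts stt; rewrite wE => <- s1 t1.
  by apply: nlt1; split; [exact: hone_neq0|rewrite sE s1|rewrite tE t1].
apply: nlt1s; split.
- move=> s0; by apply: vN1; apply/haddN_eq; rewrite sE s0.
- by rewrite haddC.
- by rewrite sNt haddC (haddN_set1 tt).
Qed.
End HyperfieldTheory.

(** * The value group *)

Section ValueGroup.
Local Open Scope quotient_scope.
Variable R : skewHyperfield.
Hypothesis stringentR : stringent R.
Implicit Types x y z : units R.

Definition unit_layer x y := `[< layer (sval x) (sval y) >].

Lemma unit_layer_refl : reflexive unit_layer.
Proof. by move=> x; apply/asboolP; exact: layerxx. Qed.

Lemma unit_layer_sym : symmetric unit_layer.
Proof. by move=> x y; apply/asboolP/asboolP; exact: layerC. Qed.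

Lemma unit_layer_trans : transitive unit_layer.
Proof.
by move=> y x z /asboolP xy /asboolP yz; apply/asboolP/(layer_trans _ xy yz).
Qed.

Canonical unit_layer_equiv :=
  EquivRel unit_layer unit_layer_refl unit_layer_sym unit_layer_trans.

Definition value_group := {eq_quot unit_layer_equiv}.

HB.instance Definition _ := Choice.on value_group.
HB.instance Definition _ := Quotient.on value_group.

Definition val_of x : value_group := \pi x.

Lemma val_ofP x y : val_of x = val_of y <-> layer (sval x) (sval y).
Proof.
split=> [/eqquotP/asboolP //|xy]; exact/eqquotP/asboolP.
Qed.

Lemma val_of_repr (a : value_group) : val_of (repr a) = a.
Proof. exact: reprK. Qed.

Lemma val_of_surj (a : value_group) : exists x, a = val_of x.
Proof. by exists (repr a); rewrite val_of_repr. Qed.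

Lemma layer_repr x : layer (sval (repr (val_of x))) (sval x).
Proof. by apply/val_ofP; rewrite val_of_repr. Qed.

Definition val_one := val_of 1%g.
Definition val_mul (a b : value_group) := val_of (repr a * repr b)%g.
Definition val_inv (a : value_group) := val_of (repr a)^-1%g.

Lemma val_mulE x y : val_mul (val_of x) (val_of y) = val_of (x * y)%g.
Proof. by apply/val_ofP/layer_mul => //; exact: layer_repr. Qed.

Lemma val_mulA : associative val_mul.
Proof.
move=> a b c; have [x ->] := val_of_surj a; have [y ->] := val_of_surj b.
by have [z ->] := val_of_surj c; rewrite !val_mulE mulgA.
Qed.

Lemma val_mul1 : left_id val_one val_mul.
Proof. by move=> a; have [x ->] := val_of_surj a; rewrite val_mulE mul1g. Qed.

Lemma val_mulr1 : right_id val_one val_mul.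
Proof. by move=> a; have [x ->] := val_of_surj a; rewrite val_mulE mulg1. Qed.

Lemma val_mulV : left_inverse val_one val_inv val_mul.
Proof. by move=> a; rewrite -{2}[a]val_of_repr val_mulE mulVg. Qed.

Lemma val_mulrV : right_inverse val_one val_inv val_mul.
Proof. by move=> a; rewrite -{1}[a]val_of_repr val_mulE mulgV. Qed.

HB.instance Definition _ := isGroup.Build value_group
  val_mulA val_mul1 val_mulr1 val_mulV val_mulrV.

Definition val_le (a b : value_group) :=
  ~~ `[< below (sval (repr b)) (sval (repr a)) >].

(** [below] is invariant under changing either argument within its layer, so the choice of
    representatives does not matter. *)
Lemma val_leE x y :
  val_le (val_of x) (val_of y) <-> ~ below (sval y) (sval x).
Proof.
have xP := layer_repr x; have yP := layer_repr y.
split=> [/asboolPn nyx yx|nyx].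
  by apply/nyx/(below_layerl _ (layerC yP))/(below_layerr _ (layerC xP)).
by apply/asboolPn => yx; apply/nyx/(below_layerl _ yP)/(below_layerr _ xP).
Qed.

Lemma val_le_refl : reflexive val_le.
Proof. by move=> a; apply/asboolPn; exact: below_irr. Qed.

(** Units neither of which is below the other are in the same layer, hence equal in the quotient. *)
Lemma val_le_anti : antisymmetric val_le.
Proof.
move=> a b /andP[/asboolPn ab /asboolPn ba].
by rewrite -[a]val_of_repr -[b]val_of_repr; apply/val_ofP.
Qed.

Lemma val_le_trans : transitive val_le.
Proof.
move=> b a c /asboolPn ab /asboolPn bc; apply/asboolPn => ca.
by have [] := below_cotrans stringentR (sval (repr b)) ca.
Qed.

HB.instance Definition _ := Order.Le_isPOrder.Build (Order.Disp tt tt)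
  value_group val_le_refl val_le_anti val_le_trans.

Lemma val_le_total : total (<=%O : rel value_group).
Proof.
move=> a b; apply/orP; have [ab|nab] := pselect (val_le a b); first by left.
right; apply/asboolPn => ab; apply: nab; apply/asboolPn; exact: below_asym.
Qed.

HB.instance Definition _ := Order.POrder_isTotal.Build (Order.Disp tt tt)
  value_group val_le_total.

Lemma val_le_mul2l (a b c : value_group) :
  (b <= c)%O -> ((a * b)%g <= (a * c)%g)%O.
Proof.
have [x ->] := val_of_surj a; have [y ->] := val_of_surj b.
have [z ->] := val_of_surj c => yz.
(* The group product is [val_mul] up to conversion; in this form [val_mulE] applies. *)
suff : val_le (val_mul (val_of x) (val_of y)) (val_mul (val_of x) (val_of z)).
  by [].
by rewrite !val_mulE val_leE /= below_mul2lE; [apply/val_leE|exact: svalP x].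
Qed.

Lemma val_le_mul2r (a b c : value_group) :
  (b <= c)%O -> ((b * a)%g <= (c * a)%g)%O.
Proof.
have [x ->] := val_of_surj a; have [y ->] := val_of_surj b.
have [z ->] := val_of_surj c => yz.
suff : val_le (val_mul (val_of y) (val_of x)) (val_mul (val_of z) (val_of x)).
  by [].
by rewrite !val_mulE val_leE /= below_mul2rE; [apply/val_leE|exact: svalP x].
Qed.

HB.instance Definition _ := isOrderedGroup.Build (Order.Disp tt tt)
  value_group val_le_mul2l val_le_mul2r.

Lemma val_ofM : {morph val_of : x y / (x * y)%g}.
Proof. by move=> x y; rewrite -val_mulE. Qed.

Lemma val_of1 : val_of 1%g = 1%g. Proof. by []. Qed.

HB.instance Definition _ := isUMagmaMorphism.Build (units R) value_group val_of
  (val_of1, val_ofM).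

Lemma val_of_lt x y : (val_of x < val_of y)%O <-> below (sval x) (sval y).
Proof.
rewrite Order.TotalTheory.ltNge; split=> [|xy].
  by move=> /negP h; apply: contrapT => /val_leE.
by apply/negP => /val_leE.
Qed.
End ValueGroup.

(** * The layering isomorphism *)

Section LayeringOfResidue.
Local Open Scope classical_set_scope.
Local Open Scope hyper_scope.

(** Such an [i] identifies [F] with the layer of [1] together with [0]. Only the trace of a sum on
    the image is compared: [i a ⊞ i b] may also contain elements below the layer. *)
Record residue_embedding (F R : skewHyperfield) (i : F -> R) : Prop :=
  ResidueEmbedding {
    re_inj : injective i;
    re_0 : i 0 = 0;
    re_1 : i 1 = 1;
    re_mul : forall a b, i (a ⊙ b) = i a ⊙ i b;
    re_add : forall a b c, (i a ⊞ i b) (i c) <-> (a ⊞ b) c;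
    re_layer : forall u, u <> 0 -> layer 1 (i u);
    re_surj : forall x, layer 1 x -> exists u, i u = x
  }.

Lemma units_val_inj (F : skewHyperfield) :
  injective (fun u : units F => sval u).
Proof. by move=> [x x0] [y y0] /= xy; exact: eq_exist. Qed.

Variables (R F : skewHyperfield) (stringentR : stringent R) (i : F -> R).
Hypothesis iP : residue_embedding i.

Let RP := @hf_hyperring R.

Lemma residue_neq0 (u : units F) : i (sval u) <> 0.
Proof. by rewrite -(re_0 iP) => /(re_inj iP); exact: (svalP u). Qed.

Definition unit_map (u : units F) : units R := mk_unit (residue_neq0 (u := u)).

Lemma unit_map_monoid : monoid_morphism unit_map.
Proof.
split; first by apply: eq_exist; exact: (re_1 iP).
by move=> u v; apply: eq_exist; exact: (re_mul iP).
Qed.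

HB.instance Definition _ := isUMagmaMorphism.Build (units F) (units R) unit_map
  unit_map_monoid.

Local Notation psi := (val_of stringentR).

(** The kernel of [psi] is the layer of [1], which is the image of the units of [F]. *)
Lemma unit_map_exact : short_exact unit_map psi.
Proof.
split.
- by move=> u v /(congr1 sval) /(re_inj iP); exact: units_val_inj.
- apply/seteqP; split=> [_ [u _ <-]|x /= /val_ofP l1].
    apply/val_ofP/layerC/(re_layer iP); exact: (svalP u).
  have [u ux] := re_surj iP (layerC l1).
  have u0 : u <> 0 by move=> u0; apply: (svalP x); rewrite -ux u0 (re_0 iP).
  by exists (mk_unit u0) => //; apply: units_val_inj.
- apply/seteqP; split=> // a _; have [x ->] := val_of_surj a.
  by exists x.
Qed.

(** Expresses conjugation through products in [R], so that stability of sums reduces to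
    distributivity there. *)
Lemma residue_conjh (h : units R) (x : F) :
  i (conjh unit_map h x) = sval h^-1%g ⊙ (i x ⊙ sval h).
Proof.
have [->|x0] := pselect (x = 0).
  by rewrite conjh0 (re_0 iP) (hr_mul0 RP) (hr_mulr0 RP).
have [y0 /(congr1 sval)] := conjhE unit_map_exact h x0.
by rewrite /conjg.
Qed.

Lemma conjhK (h : units R) :
  cancel (conjh unit_map h) (conjh unit_map h^-1%g).
Proof.
move=> x; apply: (re_inj iP); rewrite !residue_conjh invgK.
have /= hV := congr1 sval (mulgV h).
by rewrite -!(hr_mulA RP) hV (hr_mulr1 RP) (hr_mulA RP) hV (hr_mul1 RP).
Qed.

Lemma conjh_add (h : units R) (x y z : F) :
  (conjh unit_map h x ⊞ conjh unit_map h y) (conjh unit_map h z) <->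
  (x ⊞ y) z.
Proof.
rewrite -!(re_add iP) !residue_conjh.
by rewrite hadd_mul2l ?hadd_mul2r //; [exact: (svalP h)|exact: (svalP h^-1%g)].
Qed.

Lemma unit_map_stable_sums : stable_sums unit_map.
Proof.
move=> h; have hVK := conjhK h^-1%g; rewrite invgK in hVK.
have /= hV := congr1 sval (mulgV h); have /= Vh := congr1 sval (mulVg h).
split.
- by exists (conjh unit_map h^-1%g); [exact: conjhK|].
- exact: conjh0.
- by apply: (re_inj iP); rewrite residue_conjh (re_1 iP) (hr_mul1 RP).
- move=> x y; apply: (re_inj iP); rewrite (re_mul iP) !residue_conjh.
  rewrite (re_mul iP) -!(hr_mulA RP); do 2!congr (_ ⊙ _).
  by rewrite (hr_mulA RP (sval h)) hV (hr_mul1 RP).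
- move=> x y; apply/seteqP; split=> [_ [z xyz <-]|z]; first exact/conjh_add.
  by rewrite -[z]hVK => /conjh_add xyz; exists (conjh unit_map h^-1%g z).
Qed.

Local Notation lay := (layering unit_map psi).

Definition of_lay (o : lay) : R := if o is Some u then sval u else 0.

Definition to_lay (x : R) : lay :=
  match pselect (x = 0) with
  | left _ => None
  | right x0 => Some (mk_unit x0)
  end.

Lemma to_layK : cancel to_lay of_lay.
Proof. by move=> x; rewrite /to_lay; case: pselect. Qed.

Lemma of_layK : cancel of_lay to_lay.
Proof.
case=> [u|] /=; rewrite /to_lay; case: pselect => //; first by case: u.
by move=> u0; rewrite mk_unitE.
Qed.

Lemma of_lambda (h : units R) (c : F) :
  of_lay (lambda unit_map h c) = sval h ⊙ i c.
Proof.
have [->|c0] := pselect (c = 0).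
  by rewrite lambda0 (re_0 iP) (hr_mulr0 RP).
by rewrite -[c]/(sval (mk_unit c0)) lambdaE.
Qed.

(** Dividing by [h] moves its layer onto the layer of [1], which [i] covers. *)
Lemma layer_lambda (h : units R) (o : lay) :
  layer (sval h) (of_lay o) -> exists c, o = lambda unit_map h c.
Proof.
have /= hV := congr1 sval (mulgV h).
move=> ho; have [|c cE] := re_surj iP (x := sval h^-1%g ⊙ of_lay o).
  apply/(@layer_mul1l _ (sval h)); first exact: (svalP h).
  by rewrite (hr_mulA RP) hV (hr_mul1 RP).
exists c; apply: (can_inj of_layK).
by rewrite of_lambda cE (hr_mulA RP) hV (hr_mul1 RP).
Qed.

(** Multiplication by [a] carries the image of [i] onto the layer of [a] together with [0], so the
    transported sum is the trace there of the sum in [R]. *)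
Lemma of_transport_add (a b : units R) (o : lay) :
  layer (sval a) (sval b) ->
  transport_add unit_map a (Some a) (Some b) o <->
  (sval a ⊞ sval b) (of_lay o) /\ (o = None \/ layer (sval a) (of_lay o)).
Proof.
move=> ab; split=> [[x [y [z [ax bY -> xyz]]]]|[abo oP]].
  have {}ax := congr1 of_lay ax; have {}bY := congr1 of_lay bY.
  rewrite /= !of_lambda in ax bY; rewrite of_lambda; split.
    rewrite {1}ax bY; apply/hadd_mul2l; first exact: (svalP a).
    exact/(re_add iP).
  have [->|z0] := pselect (z = 0); first by left; exact: lambda0.
  right; apply/layer_mul1l; first exact: (svalP a).
  exact: (re_layer iP).
have [x ax] := @layer_lambda a (Some a) (layerxx _).
have [y bY] := @layer_lambda a (Some b) ab.
have [z oz] : exists z, o = lambda unit_map a z.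
  by case: oP => [->|/layer_lambda//]; exists 0; rewrite lambda0.
exists x, y, z; split=> //; apply/(re_add iP)/(@hadd_mul2l _ (sval a)).
  exact: (svalP a).
by rewrite -!of_lambda -ax -bY -oz.
Qed.

Lemma of_lay_add (o p q : lay) :
  (o ⊞ p) q <-> (of_lay o ⊞ of_lay p) (of_lay q).
Proof.
have set1E (r : lay) : [set r] q <-> [set of_lay r] (of_lay q).
  by split=> [->//|/(can_inj of_layK)].
case: o p => [a|] [b|] /=; rewrite ?hadd0 ?haddx0;
  [|exact: set1E|exact: set1E|exact: set1E].
case: ifPn => [/val_of_lt ba|/negP nba].
  by have [_ -> _] := ba; exact: set1E.
case: ifPn => [/val_of_lt ab|/negP nab].
  by rewrite haddC; have [_ -> _] := ab; exact: set1E.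
have ab : layer (sval a) (sval b).
  by split=> lt; [apply: nab|apply: nba]; apply/val_of_lt.
rewrite (layer_addE unit_map_exact).
have Tq := of_transport_add q ab; have TN := of_transport_add None ab.
(* [0] lies in the transported sum exactly when [b = - a]. By [hadd_layer] this is the only case
   where the sum leaves the layer, and by [haddN_below] it then contains everything below [a]. *)
case: asboolP => [/TN[/haddN_eq bNa _]|nN].
  split=> [[/Tq[]//|[c /= /val_of_lt ca <-]]|abq].
    by rewrite bNa; exact: haddN_below.
  have [aq|[_ [q0|qa]]] := hadd_layer ab abq.
  - by left; apply/Tq; split=> //; right.
  - by left; apply/Tq; split=> //; left; exact: (can_inj of_layK).
  - case: q {Tq abq} qa set1E => [c|] qa _; last first.
      by left; apply/TN; split; [exact/haddN_eq|left].
    by right; exists c => //=; apply/val_of_lt.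
split=> [/Tq[]//|abq].
have [aq|[bNa _]] := hadd_layer ab abq.
  by apply/Tq; split=> //; right.
by case: nN; apply/TN; split; [exact/haddN_eq|left].
Qed.

Lemma to_lay_iso : is_hyper_iso to_lay.
Proof.
split.
- by exists of_lay; [exact: to_layK|exact: of_layK].
- by apply: (can_inj of_layK); rewrite to_layK.
- by apply: (can_inj of_layK); rewrite to_layK.
- move=> x y; apply: (can_inj of_layK); rewrite to_layK.
  rewrite -{1}[x]to_layK -{1}[y]to_layK.
  case: (to_lay x) (to_lay y) => [a|] [b|] //=;
    by rewrite ?(hr_mul0 RP) ?(hr_mulr0 RP).
- move=> x y; apply/seteqP; split=> [_ [z xyz <-]|o].
    by apply/of_lay_add; rewrite !to_layK.
  move/of_lay_add; rewrite !to_layK => xyo.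
  by exists (of_lay o); rewrite ?of_layK.
Qed.

Lemma layering_of_residue :
  exists (d : Order.disp_t) (G : orderedGroupType d)
         (H : groupType) (phi : {grouphom units F -> H})
         (psi : {grouphom H -> G}),
    [/\ short_exact phi psi, stable_sums phi
      & hyper_isomorphic R (layering phi psi)].
Proof.
exists (Order.Disp tt tt), (value_group stringentR), (units R), unit_map, psi.
split; [exact: unit_map_exact|exact: unit_map_stable_sums|].
by exists to_lay; exact: to_lay_iso.
Qed.
End LayeringOfResidue.

(** * The layer of one *)

Section ResidueField.
Local Open Scope classical_set_scope.
Local Open Scope hyper_scope.
Variables (R : skewHyperfield) (stringentR : stringent R).
Hypothesis nidem : ~ (1 ⊞ 1) (1 : R).

Let RP := @hf_hyperring R.

Definition in_residue (x : R) := x = 0 \/ layer 1 x.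

(** The two proofs are arguments of the type because the ring structure placed on it depends on
    them. *)
Definition residue (_ : stringent R) (_ : ~ (1 ⊞ 1) (1 : R)) :=
  {x : R | in_residue x}.

Local Notation K := (residue stringentR nidem).

HB.instance Definition _ := gen_eqMixin K.
HB.instance Definition _ := gen_choiceMixin K.

Lemma residue_val_inj : injective (fun x : K => sval x).
Proof. by move=> [x x0] [y y0] /= xy; exact: eq_exist. Qed.

Lemma in_residueN x : in_residue x -> in_residue (hopp x).
Proof.
move=> [->|x1]; first by left; exact: hopp0.
by right; apply: (layer_trans stringentR x1); exact: layerN.
Qed.

Lemma in_residueM x y : in_residue x -> in_residue y -> in_residue (x ⊙ y).
Proof.
move=> [->|x1]; first by left; exact: (hr_mul0 RP).
move=> [->|y1]; first by left; exact: (hr_mulr0 RP).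
by right; rewrite -[1](hr_mul1 RP); exact: layer_mul.
Qed.

Lemma hadd_residue x y z : in_residue x -> in_residue y -> (x ⊞ y) z ->
  in_residue z \/ y = hopp x /\ below z x.
Proof.
move=> [->|x1]; first by rewrite hadd0 => yP ->; left.
move=> [->|y1]; first by rewrite haddx0 => ->; left; right.
have xy := layer_trans stringentR (layerC x1) y1.
move=> /(hadd_layer xy)[xz|[-> [->|]]].
- by left; right; exact: (layer_trans stringentR x1).
- by left; left.
- by right.
Qed.

Lemma residue_add_ex (x y : K) :
  exists z : K, (sval x ⊞ sval y) (sval z).
Proof.
case: x y => [x xP] [y yP] /=.
have [->|xy] := pselect (y = hopp x).
  by exists (exist _ 0 (or_introl erefl)); exact: haddxN.
have [z xyz] := hadd_neq0 x y.
have [zP|[]//] := hadd_residue xP yP xyz.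
by exists (exist _ z zP).
Qed.

(** Stringency settles [y <> - x]. A nonzero [w] of the residue field in [x - x] would, divided by
    [x], give an element of [1 - 1] in the layer of [1], and [layer1_idem] would contradict
    [nidem]. *)
Lemma residue_add_uniq (x y z z' : K) :
  (sval x ⊞ sval y) (sval z) -> (sval x ⊞ sval y) (sval z') -> z = z'.
Proof.
move=> xyz xyz'; apply: residue_val_inj => /=.
have [xy|xy] := pselect (sval y = hopp (sval x)); last first.
  have [|w wE] := @stringentR (sval y) (sval x); first by [].
  by move: xyz xyz'; rewrite haddC wE => -> ->.
suff oppE (w : K) : (sval x ⊞ sval y) (sval w) -> sval w = 0.
  by rewrite (oppE z xyz) (oppE z' xyz').
rewrite xy; case: (svalP x) => [->|x1].
  by rewrite hopp0 hadd0.
case: (svalP w) => [//|w1] xNxw; case: nidem.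
have x0 : sval x <> 0 by apply: (layer_neq0 (layerC x1)); exact: hone_neq0.
have /= xV := congr1 sval (mulgV (mk_unit x0)).
set v := sval (mk_unit x0)^-1%g ⊙ sval w.
have xv : sval w = sval x ⊙ v by rewrite (hr_mulA RP) xV (hr_mul1 RP).
apply: (@layer1_idem _ stringentR v).
  apply/(layer_mul1l _ x0); rewrite -xv.
  exact: layer_trans (layerC x1) w1.
move: xNxw; rewrite xv -{1 2}[sval x](hr_mulr1 RP) -hmulN.
by move/(hadd_mul2l _ _ _ x0).
Qed.

Definition residue_add (x y : K) : K := sval (cid (residue_add_ex x y)).
Definition residue_opp (x : K) : K :=
  exist in_residue (hopp (sval x)) (in_residueN (svalP x)).
Definition residue_mul (x y : K) : K :=
  exist in_residue (sval x ⊙ sval y) (in_residueM (svalP x) (svalP y)).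
Definition residue_zero : K := exist in_residue 0 (or_introl erefl).
Definition residue_one : K := exist in_residue 1 (or_intror (layerxx 1)).

Lemma residue_addP (x y z : K) :
  (sval x ⊞ sval y) (sval z) <-> residue_add x y = z.
Proof.
have h := svalP (cid (residue_add_ex x y)).
by split=> [|<-//]; exact: residue_add_uniq.
Qed.

Lemma residue_addC : commutative residue_add.
Proof. by move=> x y; apply/residue_addP; rewrite haddC; apply/residue_addP. Qed.

Lemma residue_add0 : left_id residue_zero residue_add.
Proof. by move=> x; apply/residue_addP; rewrite /= hadd0. Qed.

Lemma residue_addN : left_inverse residue_zero residue_opp residue_add.
Proof. by move=> x; apply/residue_addP; rewrite /= haddC; exact: haddxN. Qed.

(* An intermediate sum [e] outside the residue field can only arise from
   [y = - x], and is then absorbed by [z]. *)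
Lemma residue_addA : associative residue_add.
Proof.
move=> x y z; set w := residue_add x _.
have yz := (residue_addP y z _).2 erefl.
have [e xye ezw] := haddA_ex yz ((residue_addP x _ w).2 erefl).
apply/esym/residue_addP.
have [eP|[yNx ex]] := hadd_residue (svalP x) (svalP y) xye.
  by rewrite -[e]/(sval (exist in_residue e eP : K)) in xye ezw *;
    move/residue_addP: xye => ->.
have -> : residue_add x y = residue_zero.
  by apply/residue_addP; rewrite yNx; exact: haddxN.
have x1 : layer 1 (sval x).
  by case: (svalP x) => // x0; case: (below_neq0 ex).
rewrite /= hadd0; case: (svalP z) => [z0|z1].
  (* With [z = 0] one gets [w = e], which is below [x] and in the residue field, so it must be
     [0]. *)
  move: ezw; rewrite z0 haddx0 => /= we; rewrite -we in ex.
  case: (svalP w) => // w1; case: (layer_trans stringentR (layerC x1) w1) => _.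
  by [].
by apply: below_add ezw; apply: (below_layerr stringentR _ ex);
  exact: layer_trans (layerC x1) z1.
Qed.

HB.instance Definition _ := GRing.isZmodule.Build K
  residue_addA residue_addC residue_add0 residue_addN.

Lemma residue_mulA : associative residue_mul.
Proof. by move=> x y z; apply: residue_val_inj; exact: (hr_mulA RP). Qed.

Lemma residue_mul1 : left_id residue_one residue_mul.
Proof. by move=> x; apply: residue_val_inj; exact: (hr_mul1 RP). Qed.

Lemma residue_mulr1 : right_id residue_one residue_mul.
Proof. by move=> x; apply: residue_val_inj; exact: (hr_mulr1 RP). Qed.

Lemma residue_mulDl : left_distributive residue_mul residue_add.
Proof.
move=> x y z; apply/esym/residue_addP; rewrite /= -(hr_distr RP).
by exists (sval (residue_add x y)) => //; apply/residue_addP.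
Qed.

Lemma residue_mulDr : right_distributive residue_mul residue_add.
Proof.
move=> x y z; apply/esym/residue_addP; rewrite /= -(hr_distl RP).
by exists (sval (residue_add y z)) => //; apply/residue_addP.
Qed.

Lemma residue_1neq0 : residue_one != residue_zero.
Proof. by apply/eqP => /(congr1 sval) /hone_neq0. Qed.

HB.instance Definition _ := GRing.Zmodule_isNzRing.Build K
  residue_mulA residue_mul1 residue_mulr1 residue_mulDl residue_mulDr
  residue_1neq0.

(** At [0] the value follows the convention that inversion is the identity on non-units. *)
Lemma residue_inv_ex (x : K) : exists y : K,
  if x == 0%R then y = x else (y * x = 1 /\ x * y = 1)%R.
Proof.
have [->|x0] := eqVneq x 0%R; first by exists 0%R.
have vx0 : sval x <> 0.
  by move=> e; move/eqP: x0; apply; exact: residue_val_inj.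
have x1 : layer 1 (sval x) by case: (svalP x).
have [y [xy yx]] := hf_inv vx0.
have y1 : in_residue y.
  by right; apply/(layer_mul1l _ vx0)/layerC; rewrite xy.
by exists (exist in_residue y y1); split; apply: residue_val_inj.
Qed.

Definition residue_inv (x : K) : K := sval (cid (residue_inv_ex x)).

Lemma residue_invP (x : K) :
  x != 0%R -> (residue_inv x * x = 1 /\ x * residue_inv x = 1)%R.
Proof.
by move=> /negbTE x0; have := svalP (cid (residue_inv_ex x)); rewrite {1}x0.
Qed.

Lemma residue_mulVr :
  {in [pred x : K | x != 0%R], left_inverse 1%R residue_inv *%R}.
Proof. by move=> x /residue_invP[]. Qed.

Lemma residue_mulrV :
  {in [pred x : K | x != 0%R], right_inverse 1%R residue_inv *%R}.
Proof. by move=> x /residue_invP[]. Qed.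

Lemma residue_unitP (x y : K) : (y * x = 1 /\ x * y = 1)%R ->
  [pred x : K | x != 0%R] x.
Proof.
move=> [yx _]; apply/negP => /eqP x0; move: yx.
by rewrite x0 GRing.mulr0 => /esym/eqP; rewrite GRing.oner_eq0.
Qed.

Lemma residue_inv_out :
  {in [predC [pred x : K | x != 0%R]], residue_inv =1 id}.
Proof.
move=> x; rewrite !inE negbK => x0.
by have := svalP (cid (residue_inv_ex x)); rewrite {1}x0.
Qed.

HB.instance Definition _ := GRing.NzRing_hasMulInverse.Build K
  residue_mulVr residue_mulrV residue_unitP residue_inv_out.

Lemma residue_unit (x : K) : x != 0%R -> x \is a GRing.unit.
Proof. by []. Qed.

Lemma residue_field_embedding :
  @residue_embedding (skewfield_hyperfield residue_unit) R
    (fun x : K => sval x).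
Proof.
split=> //.
- exact: residue_val_inj.
- by move=> a b c; rewrite residue_addP; split=> [<-|->].
- move=> u u0; case: (svalP u) => // e; case: u0.
  exact: residue_val_inj.
- by move=> x x1; exists (exist in_residue x (or_intror x1)).
Qed.
End ResidueField.

(** * The Krasner and sign cases *)

Section IdempotentOne.
Local Open Scope classical_set_scope.
Local Open Scope hyper_scope.
Variables (R : skewHyperfield) (stringentR : stringent R).
Hypothesis idem : (1 ⊞ 1) (1 : R).

Let RP := @hf_hyperring R.

Definition of_krasner (b : krasner_hyperfield) : R := if b then 1 else 0.

(** The layer of [1] is [{1}], and [1 + 1] contains [0] because [1 = - 1], and [1] by [idem]. *)
Lemma krasner_embedding : 1 = hopp (1 : R) -> residue_embedding of_krasner.
Proof.
move=> one; have n10 := @hone_neq0 R.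
have nn : (1 ⊞ 1) (0 : R) by apply/haddN_eq.
split=> //.
- by case=> [] [] // /nesym.
- by case=> [] [] /=; rewrite ?(hr_mul1 RP) ?(hr_mul0 RP).
- move=> a b c; rewrite krasner_addE.
  case: a b c => [] [] [] //=; rewrite ?hadd0 ?haddx0; split=> //;
  first [by move=> /n10|by move=> /esym/n10].
- by case=> // _; exact: layerxx.
- move=> x /(idem_layer1 stringentR idem)[->|->]; first by exists true.
  by rewrite -one; exists true.
Qed.

Definition of_sign (s : sign_hyperfield) : R :=
  match s with SZero => 0 | SPos => 1 | SNeg => hopp 1 end.

(** Stringency reduces [1 + 1] to [{1}], while [1 - 1] contains [0], [1] and [- 1]. *)
Lemma sign_embedding : 1 <> hopp (1 : R) -> residue_embedding of_sign.
Proof.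
move=> one; have n10 := @hone_neq0 R.
have nN0 : hopp 1 <> 0 :> R by move/hopp_eq0.
have i1 : 1 ⊞ 1 = [set (1 : R)].
  by have [w wE] := stringentR one; move: idem; rewrite wE => ->.
have iN : hopp 1 ⊞ hopp 1 = [set hopp (1 : R)] by exact: haddN_set1.
have [N1 NN] := idem_haddN 1 idem.
have N0 := haddxN (1 : R).
split=> //.
- case=> [||] [||] //=;
  first [by move=> /n10|by move=> /nN0|by move=> /one
        |by move=> /esym/n10|by move=> /esym/nN0|by move=> /esym/one].
- by case=> [||] [||] /=; rewrite ?(hr_mul1 RP) ?(hr_mul0 RP) ?(hr_mulr0 RP)
    ?hmulNl ?(hr_mul1 RP) ?hopp0 ?hoppK.
- move=> a b c; rewrite sign_addE.
  case: a b c => [||] [||] [||] //=; rewrite ?hadd0 ?haddx0 ?i1 ?iN;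
  split=> //; rewrite 1?haddC //;
  first [by move=> /n10|by move=> /nN0|by move=> /one
        |by move=> /esym/n10|by move=> /esym/nN0|by move=> /esym/one].
- by case=> // _; [exact: layerxx|exact: layerN].
- move=> x /(idem_layer1 stringentR idem)[->|->]; first by exists SPos.
  by exists SNeg.
Qed.
End IdempotentOne.

Theorem theorem4p10 (R : skewHyperfield) (stringentR : stringent R) :
  exists (F : skewHyperfield) (d : Order.disp_t) (G : orderedGroupType d)
         (H : groupType) (phi : {grouphom units F -> H})
         (psi : {grouphom H -> G}),
    [/\ [\/ F = krasner_hyperfield,
            F = sign_hyperfield
          | exists (D : unitRingType)
                   (unitD : forall x : D, x != 0%R -> x \is a GRing.unit),
              F = skewfield_hyperfield unitD],
        short_exact phi psi,
        stable_sums phi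
      & hyper_isomorphic R (layering phi psi)].
Proof.
(* It remains to recognise the layer of [1] with [0]; [layering_of_residue] rebuilds [R] from it. *)
suff [F [Fkind [i iP]]] : exists F : skewHyperfield,
    [\/ F = krasner_hyperfield, F = sign_hyperfield
      | exists (D : unitRingType)
               (unitD : forall x : D, x != 0%R -> x \is a GRing.unit),
          F = skewfield_hyperfield unitD] /\
    exists i : F -> R, residue_embedding i.
  have [d [G [H [phi [psi [ex st iso]]]]]] := layering_of_residue stringentR iP.
  by exists F, d, G, H, phi, psi.
(* Whether [1] lies in [1 + 1] separates the skew field case from the other two, which [1 = - 1]
   tells apart. *)
have [idem|nidem] := pselect ((1 ⊞ 1)%H (1%H : R)); last first.
  exists (skewfield_hyperfield (@residue_unit _ stringentR nidem)).
  split; last by eexists; exact: residue_field_embedding.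
  by apply: Or33; exists (residue stringentR nidem), (@residue_unit _ _ _).
have [one|one] := pselect (1%H = hopp (1%H : R)).
  exists krasner_hyperfield; split; first exact: Or31.
  by eexists; exact: krasner_embedding one.
exists sign_hyperfield; split; first exact: Or32.
by eexists; exact: sign_embedding one.
Qed.
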